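(* (1) For any prime field $\mathbb{F}_p$ and any constant $\delta>0$, there exists a family of multiple-unicasts network instances $\mathcal{G}$ with $k$ sources, $k$ sufficiently large (i.e. for every $K$ there are such instances with some $k\ge K$), for which $$R^{\mathrm{CO}}(\mathcal{G};\mathbb{F}_p)\;\ge\;k^{1-\delta}\cdot R^{\mathrm{MU}}(\mathcal{G};\mathbb{F}_p).$$ (2) Further, for any two distinct fields $\mathbb{F}_p$ and $\mathbb{F}_q$ and any $\delta>0$, there is a large enough $k$ (i.e. for every $K$ there is some $k\ge K$) and a multiple-unicasts network $\mathcal{G}$ with $k$ sources such that $$R^{\mathrm{MU}}(\mathcal{G};\mathbb{F}_q)\;\ge\;k^{1-\delta}\cdot R^{\mathrm{MU}}(\mathcal{G};\mathbb{F}_p).$$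
   Context: **Multiple-unicasts (MU) network.** A finite acyclic directed network $\mathcal{G}(\mathcal{N},\mathcal{E})$ (parallel links allowed), where every link $e\in\mathcal{E}$ has unit capacity and is directed from its tail $t(e)$ to its head $h(e)$. There are $k$ source nodes $s_1,\dots,s_k$ and $k$ destination nodes $t_1,\dots,t_k$. For each $i$ there is a set $\mathcal{E}_i\subset\mathcal{E}$ of exactly $\mathrm{mincut}(s_i,t_i)$ *source links* of $s_i$, which have head $s_i$ and no tail; $\mathrm{mincut}(s_i,t_i)$ is the number of unit-capacity links in the minimum cut between $s_i$ and $t_i$. All links not in $\bigcup_i\mathcal{E}_i$ have a tail and a head. **Vector-linear network codes.** Let $\mathbb{F}$ be a finite field. A vector-linear relaxed-correlated MU network code over $\mathbb{F}$ with parameters $\ell\ge 1$, $r\ge 0$ consists of vectors $\mathbf{z}_e\in\mathbb{F}^\ell$, $e\in\mathcal{E}$, each a linear function of a message vector $\mathbf{x}\in\mathbb{F}^r$ (consisting of $r$ independent uniform subsymbols), where $\mathbf{x}\mapsto(\mathbf{z}_e)_{e\in\bigcup_i\mathcal{E}_i}$ is injective, such that: (1) for each non-source link $e$, $\mathbf{z}_e$ is a linear function of $\{\mathbf{z}_a: h(a)=t(e)\}$; (2) for each $i$ and each $e\in\mathcal{E}_i$, $\mathbf{z}_e$ is a linear function of the information flowing into $t_i$, i.e. of $\{\mathbf{z}_a: h(a)=t_i\}$. Its joint source entropy rate is $r/\ell$. It is a vector-linear MU network code (independent sources) if moreover (3) the families $\{\mathbf{z}_e\}_{e\in\mathcal{E}_i}$,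 $i=1,\dots,k$, are mutually independent. $R^{\mathrm{CO}}(\mathcal{G};\mathbb{F})$ is the optimum (supremum) of $r/\ell$ over relaxed-correlated codes over $\mathbb{F}$, and $R^{\mathrm{MU}}(\mathcal{G};\mathbb{F})$ (the optimum sum-rate) is the optimum over codes that also satisfy (3). $\mathbb{F}_p$ and $\mathbb{F}_q$ denote the finite fields with $p$ and $q$ elements.
   Formalization: In (2) the fields are any two finite fields of different characteristic (so all pairs of distinct prime fields); distinct fields of equal characteristic, such as those with 2 and 4 elements, are excluded, since there the two optimal sum-rates coincide and the claim fails. *)

(* Defs.v *)
From HB Require Import structures.
From mathcomp Require Import all_boot all_order all_algebra.
From mathcomp Require Import all_classical all_reals all_analysis.

Set Implicit Arguments.
Unset Strict Implicit.
Unset Printing Implicit Defensive.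

Import Order.TTheory GRing.Theory Num.Theory.
Local Open Scope ring_scope.

(* Parallel links are allowed because links form a type of their own; a link
   whose tail is [None] is a source link. *)
Record network := Network {
  node : finType;
  link : finType;
  tail_of : link -> option node;
  head_of : link -> node }.

Definition adjacent (N : network) : rel (node N) :=
  fun u v => [exists e : link N, (tail_of e == Some u) && (head_of e == v)].
Arguments adjacent : clear implicits.

Definition acyclic (N : network) : Prop :=
  forall (e : link N) (u : node N),
    tail_of e = Some u -> ~~ connect (adjacent N) (head_of e) u.

Definition cut_links (N : network) (S : {set node N}) : {set link N} :=
  [set e | (if tail_of e is Some u then u \in S else false)
           && (head_of e \notin S)].

(* The default value #|link N| of the minimum bounds the size of every cut, so
   it is irrelevant as soon as a cut exists, i.e. as soon as [s != t]. *)
Definition mincut (N : network) (s t : node N) : nat :=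
  \big[minn/#|link N|]_(S : {set node N} | (s \in S) && (t \notin S))
    #|cut_links S|.

Definition source_links_at (N : network) (v : node N) : {set link N} :=
  [set e | (tail_of e == None) && (head_of e == v)].

Definition in_links (N : network) (v : node N) : {set link N} :=
  [set a | head_of a == v].

Record MU_network (k : nat) := MUNetwork {
  MU_graph :> network;
  src : 'I_k -> node MU_graph;
  dst : 'I_k -> node MU_graph;
  MU_acyclic : acyclic MU_graph;
  src_inj : injective src;
  dst_inj : injective dst;
  src_neq_dst : forall i, src i != dst i;
  source_link_head : forall e : link MU_graph,
        tail_of e = None -> exists i, head_of e = src i;
  card_source_links : forall i,
        #|source_links_at (src i)| = mincut (src i) (dst i);
  (* Without this, networks in which no source reaches its destination would
     be allowed, and all their rates vanish. *)
  mincut_gt0 : forall i, (0 < mincut (src i) (dst i))%N }.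

Section Codes.
Variables (F : finFieldType) (k : nat) (G : MU_network k) (l r : nat).

(* The link [e] carries the vector [x *m z e], where [x : 'rV[F]_r] is the
   message. *)
Implicit Types z : link G -> 'M[F]_(r, l).

Definition source_links (i : 'I_k) : {set link G} :=
  source_links_at (src G i).

Definition linear_function_of (B : {set link G}) z (e : link G) : Prop :=
  exists A : link G -> 'M[F]_l,
    forall x : 'rV[F]_r, x *m z e = \sum_(a in B) (x *m z a) *m A a.

Definition relaxed_correlated_code z : Prop :=
  [/\ forall x y : 'rV[F]_r,
        (forall i e, e \in source_links i -> x *m z e = y *m z e) -> x = y,
      forall e v, tail_of e = Some v -> linear_function_of (in_links v) z e
    & forall i e, e \in source_links i ->
        linear_function_of (in_links (dst G i)) z e].

Definition uniform_pr (A : {set 'rV[F]_r}) : rat :=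
  #|A|%:R / #|{: 'rV[F]_r}|%:R.

(* As the sets [source_links i] are pairwise disjoint, a single [w] ranges over
   all joint values of the families. *)
Definition independent_sources z : Prop :=
  forall (J : {set 'I_k}) (w : link G -> 'rV[F]_l),
    uniform_pr [set x : 'rV[F]_r |
        [forall i in J, forall e in source_links i, x *m z e == w e]]
    = \prod_(i in J) uniform_pr [set x : 'rV[F]_r |
        [forall e in source_links i, x *m z e == w e]].

Definition MU_code z : Prop :=
  relaxed_correlated_code z /\ independent_sources z.

End Codes.

Section Rates.
Variables (R : realType) (F : finFieldType) (k : nat) (G : MU_network k).

Definition CO_rates : set R :=
  [set rho | exists l r : nat, [/\ (0 < l)%N, rho = r%:R / l%:R &
     exists z : link G -> 'M[F]_(r, l), relaxed_correlated_code z]]%classic.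

Definition MU_rates : set R :=
  [set rho | exists l r : nat, [/\ (0 < l)%N, rho = r%:R / l%:R &
     exists z : link G -> 'M[F]_(r, l), MU_code z]]%classic.

Definition R_CO : R := sup CO_rates.

Definition R_MU : R := sup MU_rates.

(* The next three lemmas show that both suprema are taken over nonempty bounded
   sets. *)
Lemma MU_rates_nonempty : MU_rates 0.
Proof.
have flat (A B : 'rV[F]_0) : A = B by apply/rowP => -[].
exists 1%N, 0%N; split=> //; first by rewrite mul0r.
exists (fun _ => 0); split.
  split=> [x y _|e v _|i e _]; first exact: flat.
  - by exists (fun _ => 0) => x; rewrite mulmx0 big1 // => a _; rewrite mulmx0.
  - by exists (fun _ => 0) => x; rewrite mulmx0 big1 // => a _; rewrite mulmx0.
move=> J w; pose b i := [forall e in source_links G i, 0 == w e].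
have prE (c : bool) : uniform_pr [set x : 'rV[F]_0 | c] = c%:R.
  rewrite /uniform_pr; case: c; last first.
    have -> : [set x : 'rV[F]_0 | false] = finset.set0.
      by apply/finset.setP=> x; rewrite !inE.
    by rewrite cards0 mul0r.
  rewrite (_ : [set _ | _] = [set: 'rV[F]_0]); last by apply/finset.setP=> x; rewrite !inE.
  by rewrite cardsT divff // pnatr_eq0 -lt0n; apply/card_gt0P; exists 0.
have -> : [set x : 'rV[F]_0 | [forall i in J, forall e in source_links G i,
    x *m 0 == w e]] = [set x | [forall i in J, b i]].
  apply/finset.setP=> x; rewrite !inE; apply: eq_forallb => i; congr (_ ==> _).
  by apply: eq_forallb => e; rewrite mulmx0.
rewrite prE (eq_bigr (fun i => (b i)%:R)); last first.
  move=> i _; rewrite -prE; congr uniform_pr; apply/finset.setP=> x; rewrite !inE.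
  by apply: eq_forallb => e; rewrite mulmx0.
case: (boolP [forall i in J, b i]) => [/forall_inP h|].
  by rewrite big1 // => i /h ->.
rewrite negb_forall_in => /exists_inP[i iJ /negbTE bi].
by rewrite (bigD1 i) //= bi mul0r.
Qed.

Lemma CO_rates_bounded : ubound CO_rates #|link G|%:R.
Proof.
move=> _ [l [r [l_gt0 -> [z [z_inj _ _]]]]].
rewrite ler_pdivrMr ?ltr0n // -natrM ler_nat.
have F_gt1 : (1 < #|F|)%N by exact: card_finNzRing_gt1.
pose f (x : 'rV[F]_r) := [ffun e => x *m z e].
have f_inj : injective f.
  by move=> x y /ffunP fxy; apply: z_inj => i e _; have := fxy e; rewrite !ffunE.
have := leq_card _ f_inj.
by rewrite card_ffun !card_mx !mul1n -expnM leq_exp2l // mulnC.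
Qed.

Lemma MU_rates_sub_CO_rates : (MU_rates `<=` CO_rates)%classic.
Proof.
by move=> _ [l [r [l_gt0 -> [z [zP _]]]]]; exists l, r; split=> //; exists z.
Qed.

End Rates.

(* Main.v *)
(** Both gaps come from networks in which every source sends its link to a
    common unit bottleneck seen by all destinations, and destination [x] also
    sees the source links of the users [y] with [N x y].

    Let [A] be a matrix with nonzero diagonal and rank at most [m].  If
    [A x y = 0] whenever [N x y], then the sum-rate over its field is at most
    [m]: writing [A x y = <al x, be y>], if [f y] is the contribution of user [y]
    to the bottleneck, then the sum of the tensors [f y (x) be y], which has
    [m * l] coordinates, determines the message.  Indeed, if it vanishes, then by
    independence the message of each user [y] can be replaced by [A x y] times
    itself; the bottleneck and the side information of [x] then vanish, and so
    does what [x] decodes, that is [A x x] times its own message.  If on the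
    contrary [A x y = 0] whenever [x != y] and not [N x y], then sending
    [be x] times a scalar message of user [x] on a bottleneck of width [m] gives
    the sum-rate [k / m].

    (1) Let the users be paired, [x] knowing its partner.  Equal messages within
    each pair are a relaxed-correlated code of rate [k / 2], while [A x y = 1] if
    [x] and [y] are on the same side of their pairs, and [0] otherwise, has rank 2.

    (2) Let [P = p ^ c], [Q = q ^ c], [s = P * Q - 1], and let the users be the
    functions [f] from [s] points to [M] values, [t] being the number of
    agreements of two of them.  The binomial coefficient [C(t, P - 1)] vanishes
    modulo [p] exactly when [P] does not divide [t + 1], likewise for [Q], and for
    distinct functions [t + 1 < P * Q], so [P] and [Q] do not both divide [t + 1].
    The side information [N f g] being "[f != g] and [P] does not divide [t + 1]",
    the two binomial matrices satisfy the two conditions above over the two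
    fields.  Counting subsets of the graphs bounds their ranks by
    [C(s * M, P - 1)] and [C(s * M, Q - 1)], powers of [M ^ 2] with exponents
    negligible with respect to [s], whereas [k = M ^ s]. *)

Require Import Defs.
From HB Require Import structures.
From mathcomp Require Import all_boot all_order all_algebra.
From mathcomp Require Import all_classical all_reals all_analysis.
From mathcomp Require Import lra.

Import Order.TTheory GRing.Theory Num.Theory.
Local Open Scope ring_scope.

Set Implicit Arguments.
Unset Strict Implicit.
Unset Printing Implicit Defensive.

(** * Minima, linear functions and uniform probability *)

Lemma bigminn_eq (I : finType) (P : pred I) (F : I -> nat) (d m : nat) (i0 : I) :
  (m <= d)%N -> P i0 -> F i0 = m -> (forall i, P i -> (m <= F i)%N) ->
  \big[minn/d]_(i | P i) F i = m.
Proof.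
move=> md Pi0 Fi0 Fmin; apply/eqP; rewrite eqn_leq; apply/andP; split.
  rewrite unlock; elim: (index_enum I) (mem_index_enum i0) => //= i s IHs.
  rewrite inE => /predU1P[<-|/IHs les]; first by rewrite Pi0 Fi0 geq_minl.
  by case: ifP => // _; rewrite geq_min les orbT.
by elim/big_ind: _ => // x y mx my; rewrite leq_min mx my.
Qed.

Lemma linear_function_ofE (F : finFieldType) (k : nat) (G : MU_network k) (l r : nat)
    (B : {set link G}) (z : link G -> 'M[F]_(r, l)) (e : link G) :
  linear_function_of B z e <->
  exists A : link G -> 'M[F]_l, z e = \sum_(a in B) z a *m A a.
Proof.
split=> -[A eA]; exists A.
  apply/row_matrixP=> i; rewrite !rowE eA mulmx_sumr.
  by apply: eq_bigr => a _; rewrite mulmxA.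
by move=> x; rewrite eA mulmx_sumr; apply: eq_bigr => a _; rewrite mulmxA.
Qed.

Lemma uniform_pr_gt0 (F : finFieldType) (r : nat) (A : {set 'rV[F]_r}) :
  (0 < uniform_pr A) = (A != finset.set0).
Proof.
have V_gt0 : (0 < #|{: 'rV[F]_r}|)%N by apply/card_gt0P; exists 0.
by rewrite /uniform_pr pmulr_lgt0 ?invr_gt0 ?ltr0n // card_gt0.
Qed.

(** * The side-information network and its min-cuts *)

Section SideInformationNetwork.
Variables (T : finType) (N : rel T).
Hypothesis N_irr : irreflexive N.

Let vertex : finType := (T + T + bool)%type.
Let edge : finType := option (T + T + T * T)%type.

Let s_ x : vertex := inl (inl x).
Let t_ x : vertex := inl (inr x).
Let u_ : vertex := inr false.
Let v_ : vertex := inr true.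

Let source x : edge := Some (inl (inl x)).
Let up x : edge := Some (inl (inr x)).
(* If [N x y] fails, then [into x y] is one more copy of the link from [v_] to
   [t_ x]: this avoids a dependent type of links. *)
Let into x y : edge := Some (inr (x, y)).
Let bottleneck : edge := None.

Definition side_tail (e : edge) : option vertex :=
  match e with
  | Some (inl (inl _)) => None
  | Some (inl (inr x)) => Some (s_ x)
  | Some (inr (x, y)) => Some (if N x y then s_ y else v_)
  | None => Some u_
  end.

Definition side_head (e : edge) : vertex :=
  match e with
  | Some (inl (inl x)) => s_ x
  | Some (inl (inr _)) => u_
  | Some (inr (x, _)) => t_ x
  | None => v_
  end.

Definition side_graph := Network side_tail side_head.

Lemma side_acyclic : acyclic side_graph.
Proof.
pose rk (w : vertex) := match w with
  | inl (inl _) => 0 | inr false => 1 | inr true => 2 | inl (inr _) => 3 end%N.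
have rk_lt e w : side_tail e = Some w -> (rk w < rk (side_head e))%N.
  by case: e => [[[x|x]|[x y]]|] //= [<-] //; case: ifP.
move=> e w /rk_lt lt_w; apply/negP => /connectP[pth].
have {lt_w}: (rk w < rk (head_of e))%N by [].
elim: pth (head_of e) => [|b pth IH] a lt_w /=.
  by move=> _ wa; rewrite wa ltnn in lt_w.
case/andP=> /existsP[/= f /andP[/eqP/rk_lt lt_f /eqP hf]] /IH; apply.
by apply: ltn_trans lt_w _; rewrite -hf.
Qed.

Lemma side_source_links x :
  source_links_at (s_ x : node side_graph) = [set source x].
Proof.
apply/finset.setP=> e; rewrite !inE.
by case: e => [[[y|y]|[y y']]|].
Qed.

Lemma side_mincut x : mincut (s_ x : node side_graph) (t_ x) = 1%N.
Proof.
(* Only the bottleneck leaves this set: it contains [u_] and every destination but [t_ x], and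
   [N x x] fails, so no link from [s_ x] gets out. *)
apply: (@bigminn_eq _ _ _ _ _ [set w : vertex | match w with
   inl (inl y) => x == y | inl (inr y) => x != y | inr b => ~~ b end]).
- by apply/card_gt0P; exists bottleneck.
- by rewrite !inE /= eqxx.
- rewrite (_ : cut_links _ = [set (bottleneck : link side_graph)]) ?cards1 //.
  apply/finset.setP=> e; rewrite !inE.
  case: e => [[[y|y]|[y y']]|] //=; rewrite ?inE /= ?andbF // negbK.
  case: ifP => //= Nyy'.
  by apply/negbTE/negP=> /andP[/eqP xy' /eqP xy]; rewrite -xy' -xy N_irr in Nyy'.
(* Conversely, every cut meets the path [up x], [bottleneck], [into x x]. *)
move=> S /andP[sS tS]; apply/card_gt0P.
have [uS|uS] := boolP (u_ \in S); last first.
  by exists (up x); rewrite inE /= sS.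
have [vS|vS] := boolP (v_ \in S).
  by exists (into x x); rewrite inE /= N_irr vS.
by exists bottleneck; rewrite inE /= uS.
Qed.

Lemma side_src_inj : injective (fun i : 'I_#|T| => s_ (enum_val i)).
Proof. by move=> i j [/enum_val_inj]. Qed.

Lemma side_dst_inj : injective (fun i : 'I_#|T| => t_ (enum_val i)).
Proof. by move=> i j [/enum_val_inj]. Qed.

Lemma side_source_head (e : link side_graph) :
  tail_of e = None -> exists i : 'I_#|T|, head_of e = s_ (enum_val i).
Proof.
by case: e => [[[x|x]|[x y]]|] // _; exists (enum_rank x); rewrite enum_rankK.
Qed.

Lemma side_card_source (i : 'I_#|T|) :
  #|source_links_at (s_ (enum_val i) : node side_graph)| =
  mincut (s_ (enum_val i) : node side_graph) (t_ (enum_val i)).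
Proof. by rewrite side_source_links cards1 side_mincut. Qed.

Lemma side_mincut_gt0 (i : 'I_#|T|) :
  (0 < mincut (s_ (enum_val i) : node side_graph) (t_ (enum_val i)))%N.
Proof. by rewrite side_mincut. Qed.

Definition side_network : MU_network #|T| :=
  @MUNetwork #|T| side_graph _ _ side_acyclic side_src_inj side_dst_inj
    (fun _ => isT) side_source_head side_card_source side_mincut_gt0.

(** * Codes on the side-information network *)

Section Codes.
Variables (F : finFieldType) (l r : nat).
Implicit Types (z : link side_network -> 'M[F]_(r, l)).

Lemma side_source_linksE i :
  source_links side_network i = [set source (enum_val i)].
Proof. exact: side_source_links. Qed.

Lemma in_links_src x : in_links (s_ x : node side_network) = [set source x].
Proof. by apply/finset.setP=> e; rewrite !inE; case: e => [[[y|y]|[y y']]|]. Qed.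

Lemma in_links_u : in_links (u_ : node side_network) = [set up x | x : T].
Proof.
apply/finset.setP=> e; rewrite !inE; apply/idP/imsetP => [|[x _ ->]] //.
by case: e => [[[x|x]|[x y]]|] //= _; exists x.
Qed.

Lemma in_links_v : in_links (v_ : node side_network) = [set bottleneck].
Proof. by apply/finset.setP=> e; rewrite !inE; case: e => [[[y|y]|[y y']]|]. Qed.

Lemma in_links_dst x : in_links (t_ x : node side_network) = [set into x y | y : T].
Proof.
apply/finset.setP=> e; rewrite !inE; apply/idP/imsetP => [|[y _ ->]] /=; last first.
  by rewrite eqxx.
by case: e => [[[y|y]|[y y']]|] //= /eqP[->]; exists y'.
Qed.

Lemma sum_in_links_u (V : nmodType) (f : link side_network -> V) :
  \sum_(a in in_links (u_ : node side_network)) f a = \sum_x f (up x).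
Proof. by rewrite in_links_u big_imset //= => x y _ _ []. Qed.

Lemma sum_in_links_dst (V : nmodType) (f : link side_network -> V) x :
  \sum_(a in in_links (t_ x : node side_network)) f a = \sum_y f (into x y).
Proof. by rewrite in_links_dst big_imset //= => y y' _ _ []. Qed.

(** Composing the linear maps along [up], [bottleneck] and [into] leaves an identity between source
    links alone; [B] collects the encoders, [D] the decoders. *)
Lemma side_code_decoders z : relaxed_correlated_code z ->
  exists (B : T -> 'M[F]_l) (D : T -> T -> 'M[F]_l), forall x,
    z (source x) = \sum_y
      (if N x y then z (source y) else \sum_w z (source w) *m B w) *m D x y.
Proof.
case=> _ enc dec.
have from_src e x : tail_of e = Some (s_ x : node side_network) ->
    exists A, z e = z (source x) *m A.
  move=> /enc/linear_function_ofE[A ->].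
  by rewrite in_links_src big_set1; exists (A (source x)).
have from_v e : tail_of e = Some (v_ : node side_network) ->
    exists A, z e = z bottleneck *m A.
  move=> /enc/linear_function_ofE[A ->].
  by rewrite in_links_v big_set1; exists (A bottleneck).
have /fin_all_exists[U zU] : forall x, exists A, z (up x) = z (source x) *m A.
  by move=> x; apply: from_src.
have /linear_function_ofE[B0 zB] := enc bottleneck u_ erefl.
rewrite sum_in_links_u in zB.
have /fin_all_exists2[E _ zE] : forall xy : T * T, exists2 A, true &
    z (into xy.1 xy.2) =
    (if N xy.1 xy.2 then z (source xy.2) else z bottleneck) *m A.
  move=> [x y] /=; case Nxy: (N x y).
    by have [|A] := from_src (into x y) y; rewrite /= ?Nxy //; exists A.
  by have [|A] := from_v (into x y); rewrite /= ?Nxy //; exists A.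
have /fin_all_exists[D0 zD] : forall x, exists A : link side_network -> 'M[F]_l,
    z (source x) = \sum_y z (into x y) *m A (into x y).
  move=> x; have := dec (enum_rank x) (source x).
  rewrite side_source_linksE enum_rankK set11 => /(_ isT)/linear_function_ofE[A ->].
  by exists A; rewrite [dst _ _]/= enum_rankK sum_in_links_dst.
exists (fun x => U x *m B0 (up x)), (fun x y => E (x, y) *m D0 x (into x y)) => x.
rewrite {1}zD; apply: eq_bigr => y _; rewrite (zE (x, y)) /= mulmxA.
congr (_ *m _ *m _); case: ifP => // _; rewrite zB.
by apply: eq_bigr => w _; rewrite zU mulmxA.
Qed.

Definition side_code (Z : T -> 'M[F]_(r, l)) (B : T -> 'M[F]_l)
    (e : link side_network) : 'M[F]_(r, l) :=
  let Y := \sum_w Z w *m B w in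
  match e with
  | Some (inl (inl x)) => Z x
  | Some (inl (inr x)) => Z x *m B x
  | Some (inr (x, y)) => if N x y then Z y else Y
  | None => Y
  end.

Lemma side_code_relaxed Z B (D : T -> T -> 'M[F]_l) :
  (forall a b : 'rV[F]_r, (forall x, a *m Z x = b *m Z x) -> a = b) ->
  (forall x, Z x = \sum_y (if N x y then Z y else \sum_w Z w *m B w) *m D x y) ->
  relaxed_correlated_code (side_code Z B).
Proof.
move=> Z_inj ZD; split.
- move=> a b ab; apply: Z_inj => x; apply: (ab (enum_rank x) (source x)).
  by rewrite side_source_linksE enum_rankK set11.
- case=> [[[x|x]|[x y]]|] // w [<-]; apply/linear_function_ofE.
  + by exists (fun=> B x); rewrite in_links_src big_set1.
  + exists (fun=> 1%:M); case Nxy: (N x y) => /=.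
      by rewrite in_links_src big_set1 Nxy mulmx1.
    by rewrite in_links_v big_set1 Nxy mulmx1.
  + by exists (fun=> 1%:M); rewrite sum_in_links_u; apply: eq_bigr => x _;
      rewrite mulmx1.
move=> i e; rewrite side_source_linksE inE => /eqP->; apply/linear_function_ofE.
exists (fun a => if a is Some (inr (x, y)) then D x y else 0).
by rewrite [dst _ _]/= sum_in_links_dst /= {1}ZD.
Qed.

(** Each source takes its value under [a x] with positive probability, so by independence all these
    values occur together with positive probability. *)
Lemma independent_sources_joint z : independent_sources z ->
  forall a : T -> 'rV[F]_r,
    exists b, forall x, b *m z (source x) = a x *m z (source x).
Proof.
move=> ind a.
pose w (e : link side_network) := if e is Some (inl (inl x)) then a x *m z e else 0.
have := ind [set: 'I_#|T|] w; move/(congr1 (fun c => 0 < c)).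
rewrite [RHS]prodr_gt0 => [|i _]; last first.
  rewrite uniform_pr_gt0; apply/set0Pn; exists (a (enum_val i)).
  by rewrite inE; apply/forall_inP => e; rewrite side_source_linksE inE => /eqP->.
rewrite uniform_pr_gt0 => /set0Pn[b]; rewrite inE => /forall_inP b_ok.
exists b => x; have /forall_inP := b_ok (enum_rank x) (finset.in_setT _).
move=> /(_ (source x)); rewrite side_source_linksE enum_rankK set11.
by move=> /(_ isT)/eqP.
Qed.

Lemma MU_code_bound z (I : finType) (al be : T -> I -> F) :
  (forall x, \sum_c al x c * be x c != 0) ->
  (forall x y, N x y -> \sum_c al x c * be y c = 0) ->
  MU_code z -> (r <= #|I| * l)%N.
Proof.
move=> A_diag A_side [zP ind]; have [B [D zD]] := side_code_decoders zP.
have [z_inj _ _] := zP.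
pose Phi (a : 'rV[F]_r) :=
  [ffun c => \sum_y be y c *: (a *m z (source y) *m B y)].
have PhiB a b : Phi a = Phi b -> Phi (a - b) = 0.
  move=> /ffunP ab; apply/ffunP=> c; move: (ab c); rewrite !ffunE => abc.
  rewrite -[RHS](subrr (\sum_y be y c *: (b *m z (source y) *m B y))) -{1}abc.
  rewrite -sumrB.
  by apply: eq_bigr => y _; rewrite !mulmxBl scalerBr.
have Phi0 a : Phi a = 0 -> a = 0.
  move=> /ffunP Phia; apply: z_inj => i e.
  rewrite side_source_linksE inE => /eqP->; set x := enum_val i; rewrite mul0mx.
  pose A y := \sum_c al x c * be y c.
  have [b zb] := independent_sources_joint ind (fun y => A y *: a).
  have Ab y : N x y -> b *m z (source y) = 0.
    by move=> Nxy; rewrite zb /A A_side // scale0r mul0mx.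
  (* On [b] the bottleneck is the sum over [c] of [al x c] times the coordinate [c] of [Phi a],
     which vanishes. *)
  have Yb : b *m (\sum_w z (source w) *m B w) = 0.
    rewrite mulmx_sumr (eq_bigr (fun w =>
        \sum_c al x c *: (be w c *: (a *m z (source w) *m B w)))); last first.
      move=> w _; rewrite mulmxA zb /A -!scalemxAl scaler_suml.
      by apply: eq_bigr => c _; rewrite scalerA.
    rewrite exchange_big big1 //= => c _; rewrite -scaler_sumr.
    by have := Phia c; rewrite !ffunE => ->; rewrite scaler0.
  have : b *m z (source x) = 0.
    rewrite zD mulmx_sumr big1 // => y _; rewrite mulmxA.
    by case: ifP => [/Ab ->|_]; rewrite ?Yb mul0mx.
  rewrite zb -scalemxAl => /eqP; rewrite scaler_eq0 (negbTE (A_diag x)) /=.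
  by move/eqP.
have Phi_inj : injective Phi.
  by move=> a b /PhiB/Phi0/eqP; rewrite subr_eq0 => /eqP.
have := leq_card _ Phi_inj.
have F_gt1 : (1 < #|F|)%N by exact: card_finNzRing_gt1.
by rewrite card_ffun !card_mx !mul1n -expnM leq_exp2l // mulnC.
Qed.

End Codes.

(** * Bounds on the sum-rate from a matrix factorisation *)

Section RateBounds.
Variables (F : finFieldType) (I : finType) (al be : T -> I -> F).
Hypothesis A_diag : forall x, \sum_c al x c * be x c != 0.

Lemma side_R_MU_le (R : realType) :
  (forall x y, N x y -> \sum_c al x c * be y c = 0) ->
  R_MU R F side_network <= #|I|%:R.
Proof.
move=> A_side; apply: ge_sup; first by exists 0; apply: MU_rates_nonempty.
move=> _ [l [r [l_gt0 -> [z zP]]]]; rewrite ler_pdivrMr ?ltr0n // -natrM ler_nat.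
exact: MU_code_bound zP.
Qed.

Let row_be x : 'rV[F]_#|I| := \row_c be x (enum_val c).
Let Z x : 'M[F]_(#|T|, #|I|) := delta_mx (enum_rank x) 0 *m row_be x.

Let row_mulZ (a : 'rV_#|T|) x : a *m Z x = a 0 (enum_rank x) *: row_be x.
Proof.
rewrite mulmxA -mul_scalar_mx; congr (_ *m _).
apply/matrixP=> i j; rewrite !ord1 !mxE (bigD1 (enum_rank x)) //= big1 ?addr0.
  by rewrite !mxE !eqxx mulr1.
by move=> k /negbTE kx; rewrite !mxE kx mulr0.
Qed.

Let row_be_neq0 x : row_be x != 0.
Proof.
apply: contraNneq (A_diag x) => be0; rewrite big1 // => c _.
move/rowP/(_ (enum_rank c)): be0; rewrite !mxE enum_rankK => ->.
by rewrite mulr0.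
Qed.

Let scale_row_be_inj x : injective (fun c => c *: row_be x).
Proof.
move=> c d /eqP; rewrite -subr_eq0 -scalerBl scaler_eq0 (negbTE (row_be_neq0 x)).
by rewrite orbF subr_eq0 => /eqP.
Qed.

Lemma side_MU_code :
  (forall x y, x != y -> ~~ N x y -> \sum_c al x c * be y c = 0) ->
  MU_code (side_code Z (fun=> 1%:M)).
Proof.
move=> A_side; pose A x y := \sum_c al x c * be y c.
(* The decoder of [x] pairs a vector with [al x], normalises by [A x x], and writes the resulting
   scalar along [be x], as source [x] does. *)
pose P x : 'M[F]_#|I| :=
    (A x x)^-1 *: ((\col_(c < #|I|) al x (enum_val c)) *m row_be x).
have ZP x y : Z y *m P x =
    ((A x x)^-1 * A x y) *: (delta_mx (enum_rank y) 0 *m row_be x).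
  rewrite -scalemxAr -scalerA; congr (_ *: _); rewrite -mulmxA scalemxAr.
  congr (_ *m _); rewrite mulmxA -mul_scalar_mx; congr (_ *m _).
  apply/matrixP=> i j; rewrite !ord1 !mxE eqxx mulr1n /A.
  rewrite (reindex (enum_val : 'I_#|I| -> I)) /=; last first.
    by apply: onW_bij; exact: enum_val_bij.
  by apply: eq_bigr => c _; rewrite !mxE mulrC.
split.
  (* Apply [P x] to the bottleneck and subtract the contributions of the known users; [P x] kills
     those of the other users [y != x]. *)
  apply: (side_code_relaxed (D := fun x y =>
      if y == x then P x else if N x y then - P x else 0)) => [a b ab|x].
    apply/rowP=> i; rewrite -(enum_valK i); apply: (@scale_row_be_inj (enum_val i)).
    by rewrite /= -!row_mulZ.
  under [\sum_w _ *m 1%:M]eq_bigr do rewrite mulmx1.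
  transitivity (\sum_y ((if y == x then (\sum_w Z w) *m P x else 0) +
      if N x y then - (Z y *m P x) else 0)); last first.
    apply: eq_bigr => y _; case: eqP => [->|_]; first by rewrite N_irr addr0.
    by rewrite add0r; case: ifP; rewrite ?mulmxN ?mulmx0.
  rewrite big_split /= -!big_mkcond big_pred1_eq mulmx_suml sumrN.
  rewrite (bigID (N x)) /= addrC addrA addNr add0r (bigD1 x) ?N_irr //= big1 ?addr0.
    by rewrite ZP mulVf ?scale1r // A_diag.
  move=> y /andP[Nxy yx]; rewrite ZP (_ : A x y = 0) ?mulr0 ?scale0r //.
  by apply: A_side; rewrite 1?eq_sym.
(* The condition on source [i] bears on coordinate [i] of the message alone, so the counts factor
   over the coordinates. *)
move=> J w; pose Q (i : 'I_#|T|) (c : F) :=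
  c *: row_be (enum_val i) == w (source (enum_val i)).
have QE (x : 'rV_#|T|) i : [forall e in source_links side_network i,
    x *m side_code Z (fun=> 1%:M) e == w e] = Q i (x 0 i).
  rewrite side_source_linksE /Q.
  have := row_mulZ x (enum_val i); rewrite enum_valK => <-.
  apply/forall_inP/idP => [|h e]; first by apply; rewrite set11.
  by rewrite inE => /eqP->.
have prE (L : {set 'I_#|T|}) :
    uniform_pr [set x : 'rV[F]_#|T| | [forall i in L, Q i (x 0 i)]] =
    \prod_(i in L) (#|[pred c | Q i c]|%:R / #|F|%:R).
  rewrite /uniform_pr card_mx mul1n.
  have <- : #|family (fun i => [pred c | (i \in L) ==> Q i c])| =
      #|[set x : 'rV[F]_#|T| | [forall i in L, Q i (x 0 i)]]|.
    have row_inj : injective (fun f : {ffun 'I_#|T| -> F} => \row_i f i).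
      by move=> f g /rowP fg; apply/ffunP=> i; have := fg i; rewrite !mxE.
    rewrite -(fintype.card_image row_inj); apply: eq_card => x; rewrite inE.
    apply/fintype.imageP/forall_inP => [[f fP -> i iL]|xP].
      by rewrite mxE; have /familyP/(_ i) := fP; rewrite inE iL.
    exists [ffun i => x 0 i]; last by apply/rowP=> i; rewrite mxE ffunE.
    by apply/familyP=> i; rewrite inE ffunE; apply/implyP/xP.
  rewrite card_family foldrE big_map big_enum /= natrX.
  rewrite -[X in _ ^+ X]card_ord -prodr_const natr_prod -prodf_div [RHS]big_mkcond.
  apply: eq_bigr => i _; case: ifP => iL.
    by congr (_%:R / _); apply: eq_card => c; rewrite !inE iL.
  rewrite (@eq_card _ _ F) => [|c]; last by rewrite !inE.
  by rewrite divff // pnatr_eq0 -lt0n; apply/card_gt0P; exists 0.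
transitivity (\prod_(i in J) (#|[pred c | Q i c]|%:R / #|F|%:R) : rat).
  rewrite -prE; congr uniform_pr; apply/finset.setP=> x; rewrite !inE.
  by apply: eq_forallb => i; rewrite QE.
apply: eq_bigr => i _; have := prE [set i]; rewrite big_set1 => <-.
congr uniform_pr; apply/finset.setP=> x; rewrite !inE QE.
apply/forall_inP/idP => [|h j]; first by apply; rewrite set11.
by rewrite inE => /eqP->.
Qed.

Lemma side_R_MU_ge (R : realType) : (0 < #|I|)%N ->
  (forall x y, x != y -> ~~ N x y -> \sum_c al x c * be y c = 0) ->
  #|T|%:R / #|I|%:R <= R_MU R F side_network.
Proof.
move=> I_gt0 A_side; apply: ub_le_sup; last first.
  by exists #|I|, #|T|; split=> //; eexists; exact: side_MU_code.
exists #|link side_network|%:R => rho /MU_rates_sub_CO_rates;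
  exact: CO_rates_bounded.
Qed.

End RateBounds.

End SideInformationNetwork.

(** * Binomial coefficients modulo a prime *)

Lemma dvdn_bin_prime_power (p e j : nat) : prime p -> (0 < j < p ^ e)%N ->
  (p %| 'C(p ^ e, j))%N.
Proof.
case: j => // j p_pr /andP[_ j_lt]; apply: contraLR j_lt => pC.
rewrite -leqNgt; apply: dvdn_leq => //.
(* Since [j.+1 * 'C(p ^ e, j.+1) = p ^ e * 'C((p ^ e).-1, j)], a binomial prime to [p] forces
   [p ^ e] to divide [j.+1]. *)
have cop : coprime (p ^ e) 'C(p ^ e, j.+1) by rewrite coprimeXl ?prime_coprime.
by rewrite -(Gauss_dvdl _ cop) -mul_bin_diag dvdn_mulr.
Qed.

(* Modulo [p], a single term of Vandermonde's convolution survives. *)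
Lemma bin_add_prime_power (p e a : nat) : prime p ->
  'C(p ^ e + a, (p ^ e).-1) = 'C(a, (p ^ e).-1) %[mod p].
Proof.
move=> p_pr; have P_gt0 : (0 < p ^ e)%N by rewrite expn_gt0 prime_gt0.
rewrite -binomial.Vandermonde big_ord_recl bin0 mul1n subn0 -modnDmr.
rewrite [X in (_ + X)%N](_ : _ = 0%N) ?addn0 //; apply/eqP.
apply: dvdn_sum => j _; apply/dvdn_mulr/dvdn_bin_prime_power => //=.
by rewrite /bump /= add1n -ltn_predRL; case: j.
Qed.

(** Both sides depend only on [a] modulo [p ^ e], and for [a < p ^ e] the binomial is zero except at
    [a = (p ^ e).-1], where it is 1. *)
Lemma dvdn_bin_prime_power_pred (p e a : nat) : prime p ->
  (p %| 'C(a, (p ^ e).-1))%N = ~~ (p ^ e %| a.+1)%N.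
Proof.
move=> p_pr; have P_gt0 : (0 < p ^ e)%N by rewrite expn_gt0 prime_gt0.
have [n] := ubnP a; elim: n a => // n IHn a; rewrite ltnS => an.
have [Pa|aP] := leqP (p ^ e) a.
  rewrite -(subnKC Pa) /dvdn bin_add_prime_power // -/(dvdn _ _).
  rewrite IHn; last first.
    by rewrite (leq_trans _ an) // ltn_subrL P_gt0 (leq_trans P_gt0).
  by rewrite -addnS modnDl.
have [aP'|] := eqVneq a (p ^ e).-1.
  by rewrite aP' binn prednK // dvdnn dvdn1 gtn_eqF ?prime_gt1.
move=> neq_a; have a_lt : (a < (p ^ e).-1)%N.
  by rewrite ltn_neqAle neq_a -ltnS prednK.
by rewrite bin_small // dvdn0 gtnNdvd //; rewrite -ltn_predRL.
Qed.

Lemma bin_leq_exp (n d : nat) : ('C(n, d) <= n ^ d)%N.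
Proof.
elim: d => [|d IHd]; first by rewrite bin0.
apply: (@leq_trans (d.+1 * 'C(n, d.+1))); first by rewrite leq_pmull.
by rewrite mul_bin_left expnS leq_mul ?leq_subr.
Qed.

(** * Subsets of graphs and the binomial matrix *)

Definition draws (X : finType) (d : nat) : finType :=
  {S in [set S : {set X} | #|S| == d]}.

Lemma card_draws_type (X : finType) (d : nat) : #|draws X d| = 'C(#|X|, d).
Proof. by rewrite card_sig -card_draws; apply: eq_card => S; rewrite !inE. Qed.

(** Counting the [d]-subsets of the intersection factors the binomial matrix through [draws X d],
    which bounds its rank. *)
Lemma bin_card_setI (V : pzSemiRingType) (X : finType) (A B : {set X}) (d : nat) :
  'C(#|A :&: B|, d)%:R =
  \sum_(S : draws X d) (val S \subset A)%:R * (val S \subset B)%:R :> V.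
Proof.
rewrite -(big_sub [set S : {set X} | #|S| == d]
  (fun S : {set X} => (S \subset A)%:R * (S \subset B)%:R)).
rewrite -cards_draws -sum1_card natr_sum big_mkcond [RHS]big_mkcond.
apply: eq_bigr => S _; rewrite !inE finset.subsetI -natrM mulnb.
by case: (_ == d); rewrite ?andbF ?andbT //; case: ifP.
Qed.

Section Agreement.
Variables s M : nat.
Implicit Types f g : {ffun 'I_s -> 'I_M}.

Definition graph f : {set 'I_s * 'I_M} := [set (i, f i) | i in 'I_s].

Lemma card_graph f : #|graph f| = s.
Proof. by rewrite card_imset ?card_ord // => i j []. Qed.

Lemma card_graphI f g : f != g -> (#|graph f :&: graph g| < s)%N.
Proof.
move=> fg; rewrite -[X in (_ < X)%N](card_graph f); apply: proper_card.
rewrite properE finset.subsetIl finset.subsetI subxx /=.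
apply: contraNN fg => /fintype.subsetP fg.
apply/eqP/ffunP=> i; have /fg/imsetP[j _ [-> ->]] // : (i, f i) \in graph f.
exact: imset_f.
Qed.

End Agreement.

(** * Paired users: correlated against independent sources *)

Section Partners.
Variables (F : finFieldType) (h : nat) (R : realType).

Definition partner : rel ('I_h * bool) := fun x y => (x.1 == y.1) && (x.2 != y.2).

Lemma partner_irr : irreflexive partner.
Proof. by move=> x; rewrite /partner !eqxx. Qed.

Lemma partner_R_MU_le : R_MU R F (side_network partner_irr) <= 2.
Proof.
rewrite -card_bool.
have sumE (x y : 'I_h * bool) :
    \sum_b (x.2 == b)%:R * (y.2 == b)%:R = (x.2 == y.2)%:R :> F.
  by rewrite big_bool; case: x.2 y.2 => -[];
    rewrite /= ?mulr0 ?mul0r ?mulr1 ?addr0 ?add0r.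
apply: (side_R_MU_le partner_irr
  (al := fun x b => (x.2 == b)%:R) (be := fun x b => (x.2 == b)%:R)).
  by move=> x; rewrite sumE eqxx oner_neq0.
by move=> x y /andP[_ /negbTE xy]; rewrite sumE xy.
Qed.

Lemma partner_R_CO_ge : h%:R <= R_CO R F (side_network partner_irr).
Proof.
apply: ub_le_sup.
  by exists #|link (side_network partner_irr)|%:R; exact: CO_rates_bounded.
exists 1%N, h; split=> //; first by rewrite divr1.
(* Both users of pair [i] send coordinate [i] of the message; the bottleneck carries zero, and each
   destination copies the link of the partner. *)
exists (side_code (N_irr := partner_irr) (fun x => delta_mx x.1 0) (fun=> 0)).
apply: (side_code_relaxed partner_irr
  (D := fun x y => (y == (x.1, ~~ x.2))%:R%:M)) => [a b ab|x].
  apply/rowP=> i; have /rowP/(_ 0) := ab (i, true).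
  by rewrite /= -!colE !mxE.
case: x => i b; rewrite (bigD1 (i, ~~ b)) //= !eqxx mulmx1 [X in _ + X]big1 ?addr0.
  by rewrite /partner /= eqxx; case: b.
by move=> y /negbTE->; rewrite -scalemx1 scale0r mulmx0.
Qed.

End Partners.

(** * Agreement networks: two characteristics *)

Section CharacteristicGap.
Variables (p q c M : nat).
Hypotheses (p_pr : prime p) (q_pr : prime q) (neq_pq : p != q).

(** [s.+1] is a multiple of both prime powers, so the diagonal entries, at [agree f f = s], are
    nonzero in both characteristics. *)
Let s := (p ^ c * q ^ c).-1.

Let agree (f g : {ffun 'I_s -> 'I_M}) : nat := #|graph f :&: graph g|.

Let sS : s.+1 = (p ^ c * q ^ c)%N.
Proof. by rewrite prednK // muln_gt0 !expn_gt0 !prime_gt0. Qed.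

Let agree_refl f : agree f f = s.
Proof. by rewrite /agree finset.setIid card_graph. Qed.

Definition agree_ndvd : rel {ffun 'I_s -> 'I_M} :=
  fun f g => (f != g) && ~~ (p ^ c %| (agree f g).+1)%N.

Lemma agree_ndvd_irr : irreflexive agree_ndvd.
Proof. by move=> f; rewrite /agree_ndvd eqxx. Qed.

Lemma agree_not_dvd f g : f != g -> ~~ agree_ndvd f g ->
  ~~ (q ^ c %| (agree f g).+1)%N.
Proof.
rewrite /agree_ndvd => fg; rewrite fg negbK => Pdvd; apply/negP => Qdvd.
have : (p ^ c * q ^ c %| (agree f g).+1)%N.
  by rewrite Gauss_dvd ?Pdvd // coprimeXl ?coprimeXr // prime_coprime // dvdn_prime2.
by rewrite -sS => /(dvdn_leq (ltn0Sn _)); rewrite ltnS leqNgt card_graphI.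
Qed.

Let bin_neq0 (F : finFieldType) (r a : nat) : r \in [pchar F] ->
  ('C(a, (r ^ c).-1)%:R == 0 :> F) = ~~ (r ^ c %| a.+1)%N.
Proof.
by move=> rF; rewrite -(dvdn_pcharf rF) dvdn_bin_prime_power_pred ?(pcharf_prime rF).
Qed.

Lemma agree_R_MU_le (R : realType) (F : finFieldType) : p \in [pchar F] ->
  R_MU R F (side_network agree_ndvd_irr) <= 'C(s * M, (p ^ c).-1)%:R.
Proof.
move=> pF; rewrite -[X in 'C(X, _)](_ : #|{: 'I_s * 'I_M}| = _); last first.
  by rewrite card_prod !card_ord.
rewrite -card_draws_type.
apply: (side_R_MU_le agree_ndvd_irr
  (al := fun f (S : draws _ _) => (val S \subset graph f)%:R)
  (be := fun f (S : draws _ _) => (val S \subset graph f)%:R)) => [f|f g].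
  by rewrite -bin_card_setI bin_neq0 // negbK -/(agree f f) agree_refl sS dvdn_mulr.
by case/andP=> fg Pndvd; apply/eqP; rewrite -bin_card_setI bin_neq0.
Qed.

Lemma agree_R_MU_ge (R : realType) (F : finFieldType) :
  (0 < M)%N -> q \in [pchar F] ->
  (M ^ s)%:R / 'C(s * M, (q ^ c).-1)%:R <= R_MU R F (side_network agree_ndvd_irr).
Proof.
move=> M_gt0 qF; rewrite -[X in 'C(X, _)](_ : #|{: 'I_s * 'I_M}| = _); last first.
  by rewrite card_prod !card_ord.
rewrite -card_draws_type -[X in (X ^ _)%:R]card_ord.
rewrite -[X in (_ ^ X)%:R]card_ord -card_ffun.
have diag (f : {ffun 'I_s -> 'I_M}) : \sum_(S : draws _ (q ^ c).-1)
    (val S \subset graph f)%:R * (val S \subset graph f)%:R != 0 :> F.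
  by rewrite -bin_card_setI bin_neq0 // negbK -/(agree f f) agree_refl sS dvdn_mull.
apply: (side_R_MU_ge agree_ndvd_irr diag) => [|f g fg Nfg].
  rewrite card_draws_type bin_gt0 card_prod !card_ord.
  rewrite (leq_trans _ (leq_pmulr _ M_gt0)) //.
  by rewrite /s -!subn1 leq_sub2r // leq_pmull // expn_gt0 prime_gt0.
by apply/eqP; rewrite -bin_card_setI bin_neq0 // agree_not_dvd.
Qed.

End CharacteristicGap.

(** * Size estimates and choice of the parameters *)

Lemma characteristic_gap_exponent (R : realType) (delta : R) (c P Q : nat) :
  8 / delta <= c%:R -> 0 < delta -> (c < P)%N -> (c < Q)%N ->
  (2 * (P.-1 + Q.-1))%:R <= (P * Q).-1%:R * delta.
Proof.
move=> c_ge d_gt0 cP cQ.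
have dge (n : nat) : (c < n)%N -> 8 <= n%:R * delta.
  by move=> cn; rewrite -ler_pdivrMr // (le_trans c_ge) // ler_nat ltnW.
have /dge P_ge := cP; have /dge Q_ge := cQ.
have P_gt0 : (0 < P)%N by case: P cP {P_ge}.
have Q_gt0 : (0 < Q)%N by case: Q cQ {Q_ge}.
have P1 : 1 <= P%:R :> R by rewrite ler1n.
have Q1 : 1 <= Q%:R :> R by rewrite ler1n.
rewrite natrM natrD -!subn1 !natrB ?muln_gt0 ?P_gt0 // natrM.
(* The product [P * Q * delta] dominates both [8 * P] and [8 * Q], and with them the terms linear in
   [P] and [Q]. *)
have hP : P%:R * 8 <= P%:R * (Q%:R * delta).
  by rewrite ler_pM2l // (lt_le_trans ltr01).
have hQ : Q%:R * 8 <= Q%:R * (P%:R * delta).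
  by rewrite ler_pM2l // (lt_le_trans ltr01).
nra.
Qed.

Lemma powR1B_le (R : realType) (k delta A B : R) :
  0 < k -> k * A <= B * k `^ delta -> k `^ (1 - delta) * A <= B.
Proof.
move=> k_gt0 le_AB; rewrite powRB ?(lt0r_neq0 k_gt0) ?implybT // powRr1 ?(ltW k_gt0) //.
by rewrite mulrAC ler_pdivrMr // powR_gt0.
Qed.

(** As [s <= M], each ['C(s * M, n)] is at most [(s * M) ^ n], hence at most [M ^ (2 * n)]; it
    remains to compare exponents of [M]. *)
Lemma characteristic_gap_size (R : realType) (delta : R) (s M d e : nat) :
  (s <= M)%N -> (0 < M)%N -> (2 * (d + e))%:R <= s%:R * delta ->
  ('C(s * M, d) * 'C(s * M, e))%:R <= (M ^ s)%:R `^ delta.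
Proof.
move=> sM M_gt0 de_le; apply: (@le_trans _ _ (M ^ (2 * (d + e)))%:R).
  rewrite ler_nat expnM expnD.
  have sMM : (s * M <= M ^ 2)%N by rewrite -mulnn leq_mul.
  have expM n : ((s * M) ^ n <= (M ^ 2) ^ n)%N by case: n => // n; rewrite leq_exp2r.
  by apply: leq_mul; apply: leq_trans (bin_leq_exp _ _) (expM _).
rewrite !natrX -!powR_mulrn ?ler0n // -powRrM.
by apply: ler_powR => //; rewrite ler1n.
Qed.

Theorem theorem6 (R : realType) :
  (forall (p : nat) (delta : R), prime p -> 0 < delta ->
     forall K : nat, exists k : nat, (K <= k)%N /\
       exists G : MU_network k,
         R_CO R 'F_p G >= k%:R `^ (1 - delta) * R_MU R 'F_p G)
  /\
  (forall (p q : nat) (Fp Fq : finFieldType) (delta : R),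
     p \in [pchar Fp] -> q \in [pchar Fq] -> p != q -> 0 < delta ->
     forall K : nat, exists k : nat, (K <= k)%N /\
       exists G : MU_network k,
         R_MU R Fq G >= k%:R `^ (1 - delta) * R_MU R Fp G).
Proof.
split=> [p delta p_pr d_gt0 K|p q Fp Fq delta pFp qFq neq_pq d_gt0 K].
  (* The 4 is the bound 2 on the independent sum-rate times the 2 of [k = h * 2]: the claim reduces
     to 4 being at most [k] to the power [delta]. *)
  have [m m_ge] : exists m : nat, 4 `^ delta^-1 <= m%:R :> R.
    by exists (Num.bound (4 `^ delta^-1 : R)); apply/ltW/archi_boundP/powR_ge0.
  pose h := (maxn m K).+1.
  have card_k : #|{: 'I_h * bool}| = (h * 2)%N by rewrite card_prod card_ord card_bool.
  exists #|{: 'I_h * bool}|; split.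
    by rewrite card_k (leq_trans (leq_maxr m K)) //
      (leq_trans (leqnSn _)) // leq_pmulr.
  exists (side_network (@partner_irr h)).
  apply: (le_trans _ (partner_R_CO_ge _ _ _)).
  apply: le_trans (ler_wpM2l (powR_ge0 _ _) (partner_R_MU_le _ _ _)) _.
  rewrite card_k; apply: powR1B_le; first by rewrite ltr0n.
  rewrite natrM -mulrA ler_wpM2l ?ler0n //.
  have -> : 2 * 2 = (4 `^ delta^-1) `^ delta :> R.
    by rewrite -powRrM mulVf ?lt0r_neq0 // powRr1 // -natrM.
  apply: ge0_ler_powR; rewrite ?nnegrE ?powR_ge0 ?(ltW d_gt0) // -natrM.
  apply: le_trans m_ge _; rewrite ler_nat.
  by rewrite (leq_trans (leq_maxl m K)) // (leq_trans (leqnSn _)) // leq_pmulr.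
have p_pr := pcharf_prime pFp; have q_pr := pcharf_prime qFq.
have [c c_ge] : exists c : nat, 8 / delta <= c%:R :> R.
  by exists (Num.bound (8 / delta)); apply/ltW/archi_boundP/divr_ge0/ltW.
have c_gt0 : (0 < c)%N by rewrite -(ltr_nat R) (lt_le_trans _ c_ge) // divr_gt0.
(* [M] exceeds [s], for the bound on the binomials, and [K], so that [k = M ^ s] does too. *)
pose s := (p ^ c * q ^ c).-1; pose M := (maxn s K).+1.
have P_gt : (c < p ^ c)%N by rewrite ltn_expl ?prime_gt1.
have Q_gt : (c < q ^ c)%N by rewrite ltn_expl ?prime_gt1.
have s_gt0 : (0 < s)%N.
  by rewrite /s -subn1 subn_gt0 (leq_ltn_trans c_gt0) // (leq_trans P_gt) //
    leq_pmulr // (leq_trans _ Q_gt).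
have card_k : #|{: {ffun 'I_s -> 'I_M}}| = (M ^ s)%N by rewrite card_ffun !card_ord.
exists #|{: {ffun 'I_s -> 'I_M}}|; split.
  by rewrite card_k (leq_trans (leq_maxr s K)) // (leq_trans (leqnSn _)) //
    -[leqLHS]expn1 leq_pexp2l.
exists (side_network (@agree_ndvd_irr p q c M)).
apply: (le_trans _ (agree_R_MU_ge c p_pr q_pr neq_pq R (ltn0Sn _) qFq)).
apply: le_trans (ler_wpM2l (powR_ge0 _ _) (agree_R_MU_le c M p_pr q_pr R pFp)) _.
rewrite card_k; apply: powR1B_le; first by rewrite ltr0n expn_gt0.
have C_gt0 : (0 < 'C(s * M, (q ^ c).-1))%N.
  rewrite bin_gt0 (leq_trans _ (leq_pmulr _ _)) // /s -!subn1 leq_sub2r //.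
  by rewrite leq_pmull // (leq_trans _ P_gt).
rewrite mulrAC ler_pdivlMr ?ltr0n // -mulrA ler_wpM2l ?ler0n // -natrM.
apply: characteristic_gap_size => //; first by rewrite /M ltnW // ltnS leq_maxl.
exact: characteristic_gap_exponent c_ge _ P_gt Q_gt.
Qed.
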